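(* Let $\bm q=(q_0,\dots,q_n)$ with $q_i\in\mathcal{S}^h(\mathbb{K}^{m+1})$ and let $W_{\bm q}:\mathcal{S}^k(\mathbb{K}^{n+1})\to\mathcal{S}^{hk}(\mathbb{K}^{m+1})$ be the linear map $\bm X^{\bm\alpha}\mapsto\prod_{i=0}^nq_i(\bm Z)^{\alpha_i}$. Let $$I=\left\{p(X_0,\ldots,X_n)\in\mathcal{S}(\mathbb{K}^{n+1})\mid p(q_0,\ldots,q_n)=0\right\}\lhd\mathcal{S}(\mathbb{K}^{n+1})$$ be the homogeneous ideal of polynomials vanishing on the variety $V_{\bm q}$. Then $W_{\bm q}$ is surjective if and only if the Hilbert function $H_I$ of $I$ satisfies $H_I(k)=\binom{hk+m}{hk}$.
   Context: $\mathbb{K}=\mathbb{R}$ or $\mathbb{C}$; $m,n,k,h$ are positive integers. $\mathcal{S}^d(\mathbb{K}^{N+1})$ is the space of homogeneous polynomials of degree $d$ in $N+1$ variables over $\mathbb{K}$, and $\mathcal{S}(\mathbb{K}^{N+1})=\bigoplus_{d\ge0}\mathcal{S}^d(\mathbb{K}^{N+1})$. Variables are $\bm X=(X_0,\dots,X_n)$, respectively $\bm Z=(Z_0,\dots,Z_m)$. $V_{\bm q}\subseteq\mathbb{P}^n(\mathbb{K})$ is the Zariski closure of the image of the rational map $\mathbb{P}^m(\mathbb{K})\dashrightarrow\mathbb{P}^n(\mathbb{K})$, $[\bm Z]\mapsto[q_0(\bm Z):\cdots:q_n(\bm Z)]$. The Hilbert function of a homogeneous ideal $I$ is $H_I(l)=\dim_{\mathbb{K}}(\mathcal{S}^l(\mathbb{K}^{n+1})/I_l)$,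 where $I_l=I\cap\mathcal{S}^l(\mathbb{K}^{n+1})$. *)

(* Defs.v *)
From HB Require Import structures.
From mathcomp Require Import all_boot all_order all_algebra.
From mathcomp Require Import boolp reals.
From mathcomp Require Import complex mpoly.

Set Implicit Arguments.
Unset Strict Implicit.
Unset Printing Implicit Defensive.

Import Order.TTheory GRing.Theory Num.Theory Quotient.

Local Open Scope ring_scope.
Local Open Scope quotient_scope.

Variant scalars := RealScalars | ComplexScalars.

Definition scalar_field (R : realType) (s : scalars) : numFieldType :=
  match s with RealScalars => R | ComplexScalars => R[i] end.

(* The quotient of a finite-dimensional space V by a linear subspace A.       *)
(* MathComp only provides the quotient group {quot A}; we add the scaling and *)
(* finite-dimensionality.                                                     *)
Section QuotientSpace.
Variables (K : fieldType) (V : vectType K) (A : submodClosed V).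

(* submodClosed lacks the opposite-closedness instance that {quot _} needs. *)
Definition submod_zpred : {pred V} := fun v => v \in A.

Lemma submod_zpred_closed : zmod_closed submod_zpred.
Proof.
split=> [|u v uA vA]; first exact: (rpred0 A).
by apply: (rpredD (S := A)); rewrite // -scaleN1r; apply: (rpredZ (s := A)).
Qed.

HB.instance Definition _ :=
  GRing.isZmodClosed.Build V submod_zpred submod_zpred_closed.

Definition quotv : Type := {quot submod_zpred}.
HB.instance Definition _ := GRing.Zmodule.on quotv.

Definition quotv_pi (v : V) : quotv := \pi_({quot submod_zpred}) v.

Lemma quotv_piD : {morph quotv_pi : u v / u + v}.
Proof. by move=> u v; rewrite /quotv_pi raddfD. Qed.

Lemma quotv_pi_eq (u v : V) : (quotv_pi u == quotv_pi v) = (u - v \in A).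
Proof. by rewrite -[LHS](idealrBE submod_zpred). Qed.

Lemma quotv_reprK (x : quotv) : quotv_pi (repr (x : {quot submod_zpred})) = x.
Proof. exact: reprK. Qed.

Definition quotv_scale (a : K) (x : quotv) : quotv :=
  quotv_pi (a *: repr (x : {quot submod_zpred})).

Lemma quotv_pi_scale a v : quotv_scale a (quotv_pi v) = quotv_pi (a *: v).
Proof.
apply/eqP; rewrite quotv_pi_eq -scalerBr rpredZ //.
by rewrite -quotv_pi_eq quotv_reprK.
Qed.

Lemma quotv_scaleA a b x :
  quotv_scale a (quotv_scale b x) = quotv_scale (a * b) x.
Proof. by rewrite -[x]quotv_reprK !quotv_pi_scale scalerA. Qed.

Lemma quotv_scale1 : left_id 1 quotv_scale.
Proof. by move=> x; rewrite -[x]quotv_reprK quotv_pi_scale scale1r. Qed.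

Lemma quotv_scaleDr : right_distributive quotv_scale +%R.
Proof.
move=> a x y; rewrite -[x]quotv_reprK -[y]quotv_reprK.
by rewrite -quotv_piD !quotv_pi_scale -quotv_piD scalerDr.
Qed.

Lemma quotv_scaleDl v : {morph quotv_scale^~ v : a b / a + b}.
Proof.
move=> a b; rewrite -[v]quotv_reprK !quotv_pi_scale.
by rewrite -quotv_piD scalerDl.
Qed.

HB.instance Definition _ := GRing.Zmodule_isLmodule.Build K quotv
  quotv_scaleA quotv_scale1 quotv_scaleDr quotv_scaleDl.

Lemma quotv_pi_is_linear : linear quotv_pi.
Proof.
by move=> a u v; rewrite quotv_piD; congr (_ + _); rewrite -quotv_pi_scale.
Qed.

HB.instance Definition _ :=
  GRing.isLinear.Build K V quotv _ quotv_pi quotv_pi_is_linear.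

Lemma submod_vspace : exists U : {vspace V}, U =i A.
Proof.
pose P d := `[< exists2 U : {vspace V}, {subset U <= A} & \dim U = d >].
have P0 : exists d, P d.
  exists 0%N; apply/asboolP; exists 0%VS; rewrite ?dimv0 // => v.
  by rewrite memv0 => /eqP->; exact: rpred0.
have Pb d : P d -> (d <= \dim {:V})%N.
  by move=> /asboolP[U _ <-]; exact/dimvS/subvf.
case: (ex_maxnP P0 Pb) => d /asboolP[U sUA dU] dmax.
exists U => v; apply/idP/idP => [/sUA // | Av].
have : P (\dim (U + <[v]>)).
  apply/asboolP; exists (U + <[v]>)%VS => // _ /memv_addP[u Uu [_ /vlineP[a ->] ->]].
  by rewrite rpredD ?rpredZ // sUA.
move/dmax; rewrite -dU => le; have /eqP -> : U == (U + <[v]>)%VS.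
  by rewrite eqEdim addvSl.
by rewrite (subvP (addvSr _ _)) // memv_line.
Qed.

Lemma quotv_vecaxiom : {d : nat & Vector.axiom d quotv}.
Proof.
have [U UA] := cid submod_vspace.
exists (\dim U^C).
pose F v := daddv_pi U^C U v.
have UC0 : (U^C :&: U = 0)%VS by rewrite capvC capv_compl.
have FB u : u - F u \in U.
  have := daddv_pi_add UC0 (w := u); rewrite addvC addv_complf memvf => /(_ isT).
  by move=> {1}<-; rewrite addrC addKr memv_pi.
have FU u : u \in U -> F u = 0.
  move=> Uu; apply/eqP; rewrite -memv0 -UC0 memv_cap memv_pi /=.
  by rewrite -[F u](subKr u) rpredB.
have Frepr v : F (repr (quotv_pi v : {quot submod_zpred})) = F v.
  apply/eqP; rewrite -subr_eq0 -linearB; apply/eqP/FU; rewrite UA.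
  by rewrite -quotv_pi_eq quotv_reprK.
pose b := vbasis U^C.
exists (fun x : quotv => \row_i coord b i (F (repr (x : {quot submod_zpred})))).
  move=> a x y; rewrite -[x]quotv_reprK -[y]quotv_reprK -linearP.
  by apply/rowP => i; rewrite !mxE !Frepr /F !linearP.
exists (fun r : 'rV_(\dim U^C) => quotv_pi (\sum_i r 0 i *: b`_i)) => [x | r].
  rewrite -[RHS]quotv_reprK; apply/eqP; rewrite quotv_pi_eq -UA -opprB rpredN.
  under eq_bigr do rewrite mxE.
  by rewrite -coord_vbasis ?memv_pi // FB.
apply/rowP => j; rewrite mxE Frepr /F daddv_pi_id //.
  by rewrite coord_sum_free // (basis_free (vbasisP _)).
by apply: rpred_sum => i _; rewrite rpredZ // vbasis_mem // mem_nth // size_tuple.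
Qed.

HB.instance Definition _ :=
  Lmodule_hasFinDim.Build K quotv (projT2 quotv_vecaxiom).

End QuotientSpace.

Section HilbertFunction.
Variables (K : fieldType) (n : nat) (I : idealr {mpoly K[n.+1]}) (l : nat).

(* I_l, as a linear subspace of the space of forms of degree l. *)
Definition graded_part : {pred dhomog n.+1 K l} :=
  fun p => (p : {mpoly K[n.+1]}) \in I.

Lemma graded_part_closed : submod_closed graded_part.
Proof.
split=> [|a p q]; rewrite /in_mem /= /graded_part ?linear0 ?rpred0 // => pI qI.
by rewrite linearP /= rpredD // -mul_mpolyC idealMr.
Qed.

HB.instance Definition _ := GRing.isSubmodClosed.Build K (dhomog n.+1 K l)
  graded_part graded_part_closed.

(* H_I(l) = dim_K (S^l / I_l) *)
Definition hilbert_function : nat := \dim {: quotv graded_part}.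

End HilbertFunction.

Section PolynomialMap.
Variables (K : fieldType) (m n h : nat) (q : 'I_n.+1 -> dhomog m.+1 K h).

Definition components : n.+1.-tuple {mpoly K[m.+1]} :=
  [tuple (q i : {mpoly K[m.+1]}) | i < n.+1].

Lemma comp_homog k (p : {mpoly K[n.+1]}) :
  p \is k.-homog -> p \mPo components \is (h * k)%N.-homog.
Proof.
move=> /dhomogP hp; rewrite comp_mpolyE big_seq rpred_sum // => a ap.
rewrite rpredZ //; have <- : (\sum_i h * a i)%N = (h * k)%N.
  by rewrite -(hp a ap) /= mdegE big_distrr.
pose P (p' : {mpoly K[m.+1]}) d := is_true (p' \is d.-homog).
rewrite -[is_true _]/(P _ _); apply: (big_ind2 P).
- exact: dhomog1.
- by move=> p1 d1 p2 d2; exact: dhomogM.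
- by move=> i _; rewrite tnth_mktuple; exact/dhomogMn/dhomog_is_dhomog.
Qed.

(* p(X) |-> p(q(Z)); composition is by definition the linear extension of     *)
(* its values on monomials, see W_monomial.                                   *)
Definition W (k : nat) (p : dhomog n.+1 K k) : dhomog m.+1 K (h * k) :=
  DHomog (comp_homog (dhomog_is_dhomog p)).

Lemma W_is_linear k : linear (@W k).
Proof. by move=> a p1 p2; apply: val_inj; rewrite /= linearP. Qed.

HB.instance Definition _ k := GRing.isLinear.Build K (dhomog n.+1 K k)
  (dhomog m.+1 K (h * k)) _ (@W k) (@W_is_linear k).

Lemma W_monomial k (a : 'X_{1..n.+1}) (ak : 'X_[K, a] \is k.-homog) :
  W (DHomog ak) = \prod_(i < n.+1) (q i : {mpoly K[m.+1]}) ^+ a i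
    :> {mpoly K[m.+1]}.
Proof.
by rewrite /= comp_mpolyX; apply: eq_bigr => i _; rewrite tnth_mktuple.
Qed.

Definition relation_ideal : {pred {mpoly K[n.+1]}} :=
  fun p => p \mPo components == 0.

Lemma relation_idealP p : reflect (p \mPo components = 0) (p \in relation_ideal).
Proof. exact: eqP. Qed.

Lemma relation_ideal_closed : idealr_closed relation_ideal.
Proof.
split; first by apply/relation_idealP; rewrite linear0.
  by apply/relation_idealP; rewrite rmorph1; apply/eqP/oner_neq0.
move=> a u v /relation_idealP u0 /relation_idealP v0; apply/relation_idealP.
by rewrite rmorphD rmorphM /= u0 v0 mulr0 addr0.
Qed.

HB.instance Definition _ :=
  isIdealr.Build {mpoly K[n.+1]} relation_ideal relation_ideal_closed.

Lemma relation_ideal_homogeneous d (p : {mpoly K[n.+1]}) : (0 < h)%N ->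
  p \in relation_ideal -> pihomog mdeg d p \in relation_ideal.
Proof.
move=> h0 /relation_idealP p0; apply/relation_idealP.
have [N [dN pN]] : exists N, (d < N /\ mmeasure mdeg p <= N)%N.
  exists (maxn d.+1 (mmeasure mdeg p)).
  by rewrite leq_maxr leq_maxl.
have <- : pihomog mdeg (h * d) (p \mPo components) =
    pihomog mdeg d p \mPo components; last by rewrite p0 linear0.
have hom e : pihomog mdeg e p \mPo components \is (h * e)%N.-homog.
  exact/comp_homog/pihomogP.
rewrite {1}(pihomog_partitionE pN) (raddf_sum (comp_mpoly components)).
rewrite (raddf_sum (pihomog mdeg _)) (bigD1 (Ordinal dN)) //.
rewrite big1 => [|i ne]; first by rewrite [LHS]addr0; exact: pihomog_dE (hom d).
by apply: pihomog_ne0 (hom i); rewrite eqn_pmul2l.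
Qed.

(* Points of P^n are represented by their nonzero coordinate vectors; sets of *)
(* points are the scaling-invariant predicates on these.                      *)
Definition map_image (x : 'I_n.+1 -> K) : Prop :=
  (exists i, x i != 0) /\
  exists2 c : K, c != 0 &
    exists z : 'I_m.+1 -> K, forall i, x i = c * (q i : {mpoly K[m.+1]}).@[z].

Definition zariski_closure (S : ('I_n.+1 -> K) -> Prop) (x : 'I_n.+1 -> K) :=
  (exists i, x i != 0) /\
  forall d (p : dhomog n.+1 K d),
    (forall y, S y -> (p : {mpoly K[n.+1]}).@[y] = 0) ->
    (p : {mpoly K[n.+1]}).@[x] = 0.

Definition variety : ('I_n.+1 -> K) -> Prop := zariski_closure map_image.

End PolynomialMap.

Section VanishingIdeal.
Variable K : numFieldType.

Lemma digits_inj N n (a b : 'I_n -> nat) :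
  (forall i, a i < N)%N -> (forall i, b i < N)%N ->
  (\sum_i a i * N ^ i = \sum_i b i * N ^ i)%N -> a =1 b.
Proof.
elim: n a b => [|n IH] a b aN bN; first by move=> _ [].
have E (c : 'I_n.+1 -> nat) : (\sum_i c i * N ^ i =
    (\sum_(i < n) c (lift ord0 i) * N ^ i) * N + c ord0)%N.
  rewrite big_ord_recl /= expn0 muln1 addnC big_distrl /=; congr addn.
  by apply: eq_bigr => i _; rewrite /bump /= add1n expnSr mulnA.
rewrite !E => e; have N0 : (0 < N)%N by exact: leq_ltn_trans (aN ord0).
have e0 : a ord0 = b ord0.
  by move/(congr1 (modn^~ N)): e; rewrite !modnMDl !modn_small.
move/eqP: e; rewrite e0 eqn_add2r eqn_pmul2r // => /eqP e i.
by have [j ->|->] := unliftP ord0 i; [exact: IH e j | exact: e0].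
Qed.

Lemma mpoly_nonroot n (p : {mpoly K[n]}) : p != 0 -> exists v, p.@[v] != 0.
Proof.
move=> p0; pose N := msize p.
pose u := mmap (@polyC K) (fun i : 'I_n => 'X^(N ^ i)) p.
have uE : u = \sum_(a <- msupp p) p@_a *: 'X^(\sum_i a i * N ^ i).
  rewrite /u /mmap; apply: eq_bigr => a _; rewrite -mul_polyC; congr (_ * _).
  rewrite /mmap1 expr_sum; apply: eq_bigr => i _.
  by rewrite -exprM mulnC.
have u0 : u != 0.
  apply/eqP => /(congr1 (fun r : {poly K} => r`_(\sum_i mlead p i * N ^ i))).
  rewrite uE coef0 coef_sum (bigD1_seq (mlead p)) ?mlead_supp //=.
  rewrite coefZ coefXn eqxx mulr1 big_seq_cond big1 => [|a /andP[ap ne]].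
    by rewrite addr0; apply/eqP; rewrite mleadc_eq0.
  have sm c : c \in msupp p -> forall i, (c i < N)%N.
    move=> cp i; apply: leq_ltn_trans (msize_mdeg_lt cp).
    by rewrite mdegE (bigD1 i) //= leq_addr.
  rewrite coefZ coefXn; case: eqP => [e|_]; last by rewrite mulr0.
  case/eqP: ne; apply/mnmP => i; symmetry.
  exact: digits_inj (sm _ (mlead_supp p0)) (sm _ ap) e i.
have [t ut] : exists t, ~~ root u t.
  pose s := [seq i%:R : K | i <- iota 0 (size u)].
  have us : uniq s.
    by rewrite map_inj_uniq ?iota_uniq // => i j /mulrIn; apply; exact: oner_neq0.
  have : ~~ all (root u) s.
    by apply/negP => /(max_poly_roots u0)/(_ us); rewrite size_map size_iota ltnn.
  by case/allPn => t _ ut; exists t.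
exists (fun i => t ^+ (N ^ i)); move: ut; rewrite /root uE mevalE.
rewrite horner_sum; congr (_ != _); apply: eq_bigr => a _.
rewrite hornerZ hornerXn expr_sum; congr (_ * _); apply: eq_bigr => i _.
by rewrite -exprM mulnC.
Qed.

Variables (m n h : nat) (q : 'I_n.+1 -> dhomog m.+1 K h).

Lemma meval_homog_scale k d (p : {mpoly K[k]}) c (x : 'I_k -> K) :
  p \is d.-homog -> p.@[fun i => c * x i] = c ^+ d * p.@[x].
Proof.
move=> /dhomogP hp; rewrite !mevalE big_distrr /=.
apply: eq_big_seq => a /hp /= <-; rewrite mulrCA; congr (_ * _).
rewrite mdegE expr_sum -big_split /=; apply: eq_bigr => i _.
by rewrite exprMn.
Qed.

Lemma meval_components (p : {mpoly K[n.+1]}) (z : 'I_m.+1 -> K) :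
  (p \mPo components q).@[z] = p.@[fun i => (q i : {mpoly K[m.+1]}).@[z]].
Proof.
by rewrite comp_mpoly_meval; apply: meval_eq => i; rewrite tnth_mktuple.
Qed.

(* relation_ideal q is the homogeneous vanishing ideal of the variety of q.   *)
(* For q = 0 the rational map is nowhere defined and the two ideals differ in *)
(* degree 0.                                                                  *)
Lemma relation_ideal_variety (p : {mpoly K[n.+1]}) :
  (0 < h)%N -> (exists i, q i != 0) ->
  p \in relation_ideal q <->
  forall d (x : 'I_n.+1 -> K), variety q x -> (pihomog mdeg d p).@[x] = 0.
Proof.
move=> h0 [i0 q0]; split=> [pI d x [_ xV] | pV].
  apply: (xV d (DHomog (pihomogP mdeg d p))) => y [_ [c _ [z yE]]] /=.
  rewrite (meval_eq _ yE) (meval_homog_scale _ _ (pihomogP mdeg d p)).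
  rewrite -meval_components.
  have /relation_idealP -> := relation_ideal_homogeneous d h0 pI.
  by rewrite meval0 mulr0.
apply/relation_idealP; rewrite (pihomog_partitionE (leqnn (mmeasure mdeg p))).
rewrite (raddf_sum (comp_mpoly (components q))) big1 //= => d _; apply/eqP/negPn/negP => nz.
have /mpoly_nonroot[z] : (pihomog mdeg d p \mPo components q) *
    (q i0 : {mpoly K[m.+1]}) != 0.
  by rewrite mulf_neq0.
rewrite mevalM mulf_eq0 negb_or meval_components => /andP[/eqP pz qz]; case: pz.
have y0 : exists i, (q i : {mpoly K[m.+1]}).@[z] != 0 by exists i0.
apply: pV; split=> // e r; apply; split=> //.
by exists 1; rewrite ?oner_neq0 //; exists z => i; rewrite mul1r.
Qed.

End VanishingIdeal.

(* Main.v *)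
Require Import Defs.
From HB Require Import structures.
From mathcomp Require Import all_boot all_order all_algebra.
From mathcomp Require Import boolp reals.
From mathcomp Require Import complex mpoly.

(** The degree-$k$ part $I_k$ is exactly the kernel of $W_{\bm q}$, so $\mathcal{S}^k/I_k$ is
    isomorphic to its image and $H_I(k)$ is the rank of $W_{\bm q}$ ([dim_quotv_limg]). A linear map
    into a finite-dimensional space is onto iff its rank is the dimension of the target
    ([limg_fullP]), here $\binom{hk+m}{hk}$ ([dim_dhomog]). *)

Lemma dim_quotv_limg (K : fieldType) (V W : vectType K) (A : submodClosed V)
    (f : 'Hom(V, W)) :
  (forall v, (v \in A) = (v \in lker f)) -> \dim {: quotv A} = \dim (limg f).
Proof.
move=> kerf; pose pi := linfun (@quotv_pi K V A).
have ker_pi : lker pi = lker f.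
  apply/vspaceP => v; rewrite -kerf memv_ker lfunE /=.
  by rewrite -(GRing.linear0 (@quotv_pi K V A)) quotv_pi_eq GRing.subr0.
have img_pi : limg pi = fullv.
  apply/vspaceP => x; rewrite memvf -[x]quotv_reprK.
  by rewrite -(lfunE (@quotv_pi K V A)) memv_img ?memvf.
(* [pi] and [f] share a kernel; once its dimension is added, rank-nullity turns both sides into
   $\dim V$. *)
apply/eqP; rewrite -(eqn_add2l (\dim (lker f))) -{1}ker_pi -img_pi.
by rewrite -[lker pi]capfv -[lker f]capfv !limg_ker_dim.
Qed.

Lemma limg_fullP {K : fieldType} {V W : vectType K} (f : 'Hom(V, W)) :
  (forall w, exists v, f v = w) <-> \dim (limg f) = \dim {: W}.
Proof.
split=> [surj | /eqP dimf w].
  congr (\dim _); apply/vspaceP => w; rewrite memvf.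
  by have [v <-] := surj w; rewrite memv_img ?memvf.
have /eqP imgf : limg f == fullv by rewrite eqEdim subvf (eqP dimf) leqnn.
by have /memv_imgP[v _ ->] : w \in limg f by [rewrite imgf memvf]; exists v.
Qed.

(** The binomial counts the monomials of degree $d$ in $m+1$ variables, which form a basis. *)
Lemma dim_dhomog (K : fieldType) (m d : nat) :
  \dim {: dhomog m.+1 K d} = 'C(d + m, d).
Proof. by rewrite dimvf. Qed.

Theorem proposition3p9 (R : realType) (s : scalars) (m n k h : nat)
    (hm : (0 < m)%N) (hn : (0 < n)%N) (hk : (0 < k)%N) (hh : (0 < h)%N)
    (q : 'I_n.+1 -> dhomog m.+1 (scalar_field R s) h) :
  (forall g : dhomog m.+1 (scalar_field R s) (h * k),
      exists f : dhomog n.+1 (scalar_field R s) k, W q f = g)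
  <-> hilbert_function (relation_ideal q) k = 'C(h * k + m, h * k).
Proof.
pose f := linfun (@W _ _ _ _ q k).
have -> : hilbert_function (relation_ideal q) k = \dim (limg f).
  apply: dim_quotv_limg => p; rewrite memv_ker lfunE /=.
  (* Forms are equal iff their underlying polynomials are, so [W q p == 0] unfolds to the membership
     test of [relation_ideal]. *)
  by rewrite -(inj_eq val_inj).
rewrite -(dim_dhomog (scalar_field R s)).
by split=> [surj | /limg_fullP surj g];
  [apply/limg_fullP => g | ]; have [p <-] := surj g; exists p; rewrite lfunE.
Qed.
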